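(* Let $M_b\in\{0,1\}^{m\times n}$ be the adjacency matrix of a bipartite graph $G_b$ in which every vertex is connected to at least one other vertex, and let $S_d$ (for $d>0$) and $F$ be the sets of matrices defined in the context. As $d$ goes to infinity, the elements of $S_d$ get closer to elements of $F$, i.e. for every $\epsilon>0$ there exists $D$ such that for all $d>D$: $$\max_{vw\in S_d}\ \min_{v_bw_b\in F}\ \|vw-v_bw_b\|_F<\epsilon .$$
   Context: Let $M_d=(1+d)M_b-d\,\mathbf 1_{m\times n}$ with $d>0$, where $\mathbf 1_{m\times n}$ is the all-ones matrix; thus $M_d$ is $M_b$ with its zero entries replaced by $-d$. Here $v$ denotes a column vector in $\mathbb{R}^m$ and $w$ a row vector in $\mathbb{R}^n$, so $vw\in\mathbb{R}^{m\times n}$; maxima of vectors are entrywise. $S_d$ is the set of nonzero matrices $vw\in\mathbb{R}^{m\times n}$ such that $v,w\ne\mathbf 0$ satisfy $$v=\max\Big(\mathbf 0,\frac{M_dw^T}{\|w\|_2^2}\Big)\quad\text{and}\quad w=\max\Big(\mathbf 0,\frac{v^TM_d}{\|v\|_2^2}\Big);$$ these are the nontrivial stationary (KKT) points of $\min_{v\ge\mathbf 0,\,w\ge\mathbf 0}\|M_d-vw\|_F^2$. $F$ is the set of matrices $v_bw_b$ with $v_b\in\{0,1\}^m$, $w_b\in\{0,1\}^n$ and $(v_b)_i(w_b)_j\le M_b(i,j)$ for all $i,j$ (these correspond to bicliques of $G_b$, i.e. feasible solutions of the maximum edge biclique problem). *)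

(* Defs.v *)
From HB Require Import structures.
From mathcomp Require Import all_boot all_order all_algebra.
From mathcomp Require Import all_classical all_reals.

Set Implicit Arguments.
Unset Strict Implicit.
Unset Printing Implicit Defensive.

Import Order.TTheory GRing.Theory Num.Theory.

Local Open Scope classical_set_scope.
Local Open Scope ring_scope.

(* The two sides of the graph are 'I_m (inl) and 'I_n (inr). *)
Definition bipartite_graph (m n : nat) (e : rel ('I_m + 'I_n)) : Prop :=
  [/\ symmetric e,
      forall i i' : 'I_m, ~~ e (inl i) (inl i') &
      forall j j' : 'I_n, ~~ e (inr j) (inr j')].

Definition no_isolated_vertex (T : finType) (e : rel T) : Prop :=
  forall x : T, exists2 y : T, y != x & e x y.

Definition is_maximum (R : realType) (X : set R) (x : R) : Prop :=
  X x /\ ubound X x.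

Definition is_minimum (R : realType) (X : set R) (x : R) : Prop :=
  X x /\ lbound X x.

Section Matrices.
Context {R : realType} {m n : nat}.

(* On a row or column vector this is the Euclidean norm. *)
Definition frobenius_norm (p q : nat) (A : 'M[R]_(p, q)) : R :=
  Num.sqrt (\sum_(i < p) \sum_(j < q) A i j ^+ 2).

Definition pos_part (p q : nat) (A : 'M[R]_(p, q)) : 'M[R]_(p, q) :=
  map_mx (Num.max 0) A.

Definition binary_mx (p q : nat) (A : 'M[R]_(p, q)) : Prop :=
  forall i j, A i j = 0 \/ A i j = 1.

Definition adjacency_mx (e : rel ('I_m + 'I_n)) : 'M[R]_(m, n) :=
  \matrix_(i, j) (e (inl i) (inr j))%:R.

Definition penalized_mx (d : R) (Mb : 'M[R]_(m, n)) : 'M[R]_(m, n) :=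
  (1 + d) *: Mb - d *: const_mx 1.

Definition stationary_set (M : 'M[R]_(m, n)) : set 'M[R]_(m, n) :=
  [set A | A != 0 /\ exists (v : 'cV[R]_m) (w : 'rV[R]_n),
    [/\ A = v *m w, v != 0, w != 0,
        v = pos_part ((frobenius_norm w ^+ 2)^-1 *: (M *m w^T)) &
        w = pos_part ((frobenius_norm v ^+ 2)^-1 *: (v^T *m M))]].

Definition biclique_set (Mb : 'M[R]_(m, n)) : set 'M[R]_(m, n) :=
  [set B | exists (vb : 'cV[R]_m) (wb : 'rV[R]_n),
    [/\ B = vb *m wb, binary_mx vb, binary_mx wb &
        forall i j, vb i 0 * wb 0 j <= Mb i j]].

Definition is_dist_to (F : set 'M[R]_(m, n)) (A : 'M[R]_(m, n)) (delta : R) :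
    Prop :=
  is_minimum [set frobenius_norm (A - B) | B in F] delta.

Definition is_max_dist (S F : set 'M[R]_(m, n)) (mu : R) : Prop :=
  is_maximum [set delta | exists2 A, S A & is_dist_to F A delta] mu.

(* The minimum in [is_dist_to] exists for every matrix when [F] is the set of
   bicliques, so the set in [is_max_dist] omits no element of [S]. *)
Lemma is_dist_to_biclique_ex (e : rel ('I_m + 'I_n)) (A : 'M[R]_(m, n)) :
  exists delta, is_dist_to (biclique_set (adjacency_mx e)) A delta.
Proof.
pose V := ('cV[bool]_m * 'rV[bool]_n)%type.
pose f (x : V) : 'M[R]_(m, n) :=
  map_mx (fun b : bool => b%:R) x.1 *m map_mx (fun b : bool => b%:R) x.2.
pose P (x : V) := [forall i, forall j, x.1 i 0 && x.2 0 j ==> e (inl i) (inr j)].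
have inF B : biclique_set (adjacency_mx e) B <-> exists2 x, P x & B = f x.
  split=> [[v [w [-> bv bw le]]]|[x /'forall_forallP Px ->]].
    exists (map_mx (fun a => a == 1) v, map_mx (fun a => a == 1) w).
      apply/'forall_forallP => i j; apply/implyP; rewrite !mxE /=.
      case/andP => /eqP vi /eqP wj; move: (le i j); rewrite vi wj !mxE mulr1.
      by case: (e _ _) => //=; rewrite ler10.
    have bool_mxE p q (C : 'M[R]_(p, q)) : binary_mx C ->
        map_mx (fun b : bool => b%:R) (map_mx (fun a => a == 1) C) = C.
      move=> bC; apply/matrixP => i j; rewrite !mxE.
      by case: (bC i j) => ->; rewrite ?eqxx // eq_sym oner_eq0.
    by rewrite /f !bool_mxE.
  exists (map_mx (fun b : bool => b%:R) x.1), (map_mx (fun b : bool => b%:R) x.2).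
  split=> // [i j|i j|i j]; rewrite !mxE.
  - by case: (x.1 i j); [right|left].
  - by case: (x.2 i j); [right|left].
  - by rewrite -natrM ler_nat mulnb; case: (_ && _) (Px i j) => //= ->.
have P0 : P (const_mx false, const_mx false).
  by apply/'forall_forallP => i j; rewrite !mxE.
pose g x := frobenius_norm (A - f x).
case: (Order.TotalTheory.arg_minP g P0) => x Px minx.
exists (g x); split; first by exists (f x) => //; apply/inF; exists x.
by move=> _ [_ /inF[y Py ->] <-]; exact: minx.
Qed.

End Matrices.

(* Main.v *)
Require Import Defs.
From HB Require Import structures.
From mathcomp Require Import all_boot all_order all_algebra.
From mathcomp Require Import all_classical all_reals all_analysis.
From mathcomp Require Import ring lra.

Set Implicit Arguments.
Unset Strict Implicit.
Unset Printing Implicit Defensive.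

Import Order.TTheory GRing.Theory Num.Theory.
Import numFieldNormedType.Exports.

Local Open Scope classical_set_scope.
Local Open Scope ring_scope.

(** A stationary point is [s u z] with [u], [z] nonnegative unit vectors,
[s u = max 0 (M_d z)] and [s z = max 0 (M_d^T u)]. If [i], [j] are not adjacent
and [u_i > 0], positivity of [(M_d z)_i] forces [d z_j <= n]; symmetrically
[z_j > 0] forces [d u_i <= m]. Call an entry large if it exceeds [(m + n) / d].
A large [u_i] thus has [z_j = 0] at every non-neighbour [j], so
[s u_i = \sum_j z_j]: the large entries span a biclique on which [u] and [z]
are constant. Since [z] has norm 1, [s u_i z_j = (\sum_k z_k) z_j] is
[1 + O(1/d)] there, and it is [O(1/d)] elsewhere. When [d > m^2] some
[u_i] exceeds [m / d], which already forces [s u_i = \sum_j z_j]; hence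
[s >= s u_i = \sum_j z_j >= 1].

The maximum is attained because [s >= 1] for large [d]: the points of [S_d] are
then the images of a closed subset of the unit sphere under
[w |-> max 0 (M_d w^T) w]. That set is nonempty because every maximal biclique
is stationary once [d >= m, n]. *)

(** * Entries and entry sums of nonnegative unit vectors *)

Section UnitVector.
Variables (R : realDomainType) (I : finType) (u : I -> R).
Hypotheses (u_ge0 : forall i, 0 <= u i) (u_unit : \sum_i u i ^+ 2 = 1).

Lemma unit_vector_le1 i : u i <= 1.
Proof.
rewrite -(@expr_le1 _ 2) // -u_unit (bigD1 i) //= lerDl.
by apply: sumr_ge0 => j _; exact: sqr_ge0.
Qed.

Lemma unit_vector_sum_ge1 : 1 <= \sum_i u i.
Proof.
rewrite -u_unit; apply: ler_sum => i _.
by rewrite expr2 ler_piMr ?unit_vector_le1.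
Qed.

Lemma unit_vector_sum_le : \sum_i u i <= #|I|%:R.
Proof.
by rewrite -sumr_const; apply: ler_sum => i _; exact: unit_vector_le1.
Qed.

End UnitVector.

(** * Consequences of a single stationarity equation *)

Section HalfStationary.
Variables (R : realFieldType) (I J : finType) (E : I -> J -> bool) (d s : R).
Variables (u : I -> R) (z : J -> R).
Hypotheses (d_gt0 : 0 < d) (s_gt0 : 0 < s).
Hypotheses (z_ge0 : forall j, 0 <= z j) (z_unit : \sum_j z j ^+ 2 = 1).
Hypothesis u_eq :
  forall i, s * u i = Num.max 0 (\sum_j (if E i j then 1 else - d) * z j).

Lemma penalized_term_le i j : (if E i j then 1 else - d) * z j <= z j.
Proof.
case: (E i j); first by rewrite mul1r.
by apply: (@le_trans _ _ 0) => //; rewrite mulNr oppr_le0 mulr_ge0 // ltW.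
Qed.

Lemma stationary_le i : s * u i <= \sum_j z j.
Proof.
rewrite u_eq ge_max sumr_ge0 // ler_sum // => j _.
exact: penalized_term_le.
Qed.

(** A positive [u i] makes the sum in [u_eq] positive, so the other terms outweigh [- d * z j]; each
    of them is at most an entry of [z], hence at most 1. *)
Lemma nonedge_le i j : ~~ E i j -> 0 < u i -> d * z j <= #|J|%:R.
Proof.
move=> nE ui; have : 0 < s * u i by rewrite mulr_gt0.
rewrite u_eq lt_max ltxx /= (bigD1 j) //= (negbTE nE) mulNr => lt0.
have : d * z j <= \sum_(k | k != j) (if E i k then 1 else - d) * z k.
  by rewrite -subr_ge0 addrC ltW.
move=> /le_trans; apply; apply: le_trans (unit_vector_sum_le z_ge0 z_unit).
apply: (@le_trans _ _ (\sum_(k | k != j) z k)); last first.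
  by rewrite [leRHS](bigD1 j) //= lerDr.
by apply: ler_sum => k _; exact: penalized_term_le.
Qed.

End HalfStationary.

(** * Large entries and the scale [s], from both equations *)

Section LargeEntries.
Variables (R : realFieldType) (I J : finType) (E : I -> J -> bool) (d s : R).
Variables (u : I -> R) (z : J -> R).
Hypotheses (d_gt0 : 0 < d) (s_gt0 : 0 < s).
Hypotheses (u_ge0 : forall i, 0 <= u i) (u_unit : \sum_i u i ^+ 2 = 1).
Hypotheses (z_ge0 : forall j, 0 <= z j) (z_unit : \sum_j z j ^+ 2 = 1).
Hypothesis u_eq :
  forall i, s * u i = Num.max 0 (\sum_j (if E i j then 1 else - d) * z j).
Hypothesis z_eq :
  forall j, s * z j = Num.max 0 (\sum_i (if E i j then 1 else - d) * u i).

(** By [nonedge_le] with the two sides exchanged, so large a [u i] forces [z j = 0] at every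
    non-neighbour: no penalty survives in row [i]. *)
Lemma large_entry_eq i : #|I|%:R < d * u i -> s * u i = \sum_j z j.
Proof.
move=> ui; rewrite u_eq.
have -> : \sum_j (if E i j then 1 else - d) * z j = \sum_j z j.
  apply: eq_bigr => j _; case: ifPn => [_|nE]; first by rewrite mul1r.
  have [zj|zj] := ltP 0 (z j).
    have := nonedge_le (E := fun j i => E i j)
      d_gt0 s_gt0 u_ge0 u_unit z_eq nE zj.
    by rewrite leNgt ui.
  by have -> : z j = 0 by [apply: le_anti; rewrite zj z_ge0]; rewrite mulr0.
by apply/max_idPr/sumr_ge0.
Qed.

Lemma large_entries_edge i j :
  #|J|%:R < d * z j -> 0 < u i -> E i j.
Proof.
move=> zj ui; apply/negPn/negP => nE.
have := nonedge_le d_gt0 s_gt0 z_ge0 z_unit u_eq nE ui.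
by rewrite leNgt zj.
Qed.

Lemma stationary_scale_le : s <= #|I|%:R * #|J|%:R.
Proof.
apply: (@le_trans _ _ (s * \sum_i u i)).
  by rewrite ler_peMr ?unit_vector_sum_ge1 // ltW.
rewrite mulr_sumr mulr_natl -sumr_const; apply: ler_sum => i _.
exact: le_trans (stationary_le d_gt0 z_ge0 u_eq i)
                (unit_vector_sum_le z_ge0 z_unit).
Qed.

Lemma stationary_scale_ge1 : #|I|%:R * #|I|%:R < d -> 1 <= s.
Proof.
(* Otherwise [d <= d * \sum_i u i <= #|I| ^ 2], as a nonnegative unit vector sums to at least 1. *)
move=> d_gt; have [i ui] : exists i, #|I|%:R < d * u i.
  apply: contrapT => /forallNP ui; move: d_gt; apply/negP; rewrite -leNgt.
  apply: (@le_trans _ _ (d * \sum_i u i)).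
    by rewrite ler_peMr ?unit_vector_sum_ge1 // ltW.
  rewrite mulr_sumr [leRHS]mulr_natl -sumr_const; apply: ler_sum => i _.
  by rewrite leNgt; apply/negP/ui.
apply: (@le_trans _ _ (\sum_j z j)); first exact: unit_vector_sum_ge1.
rewrite -(large_entry_eq ui) ler_piMr ?unit_vector_le1 //; exact: ltW.
Qed.

End LargeEntries.

(** * Entrywise distance to a 0-1 matrix *)

Section NearBiclique.
Variables (R : realFieldType) (I J : finType) (E : I -> J -> bool) (d s N : R).
Variables (u : I -> R) (z : J -> R).
Hypotheses (d_gt0 : 0 < d) (s_gt0 : 0 < s).
Hypotheses (u_ge0 : forall i, 0 <= u i) (u_unit : \sum_i u i ^+ 2 = 1).
Hypotheses (z_ge0 : forall j, 0 <= z j) (z_unit : \sum_j z j ^+ 2 = 1).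
Hypothesis u_eq :
  forall i, s * u i = Num.max 0 (\sum_j (if E i j then 1 else - d) * z j).
Hypothesis z_eq :
  forall j, s * z j = Num.max 0 (\sum_i (if E i j then 1 else - d) * u i).
Hypotheses (N_ge1 : 1 <= N) (leIN : #|I|%:R <= N) (leJN : #|J|%:R <= N).

(* On the large entries [z] is constant, so [(\sum_k z k) * z j] differs from
   [\sum_k z k ^+ 2 = 1] only by terms in the small entries. *)
Lemma large_entry_sum j :
  N < d * z j -> `|(\sum_k z k) * z j - 1| <= N ^+ 2 / d.
Proof.
move=> zj; have zconst k : N < d * z k -> z k = z j.
  move=> zk; apply: (mulfI (lt0r_neq0 s_gt0)).
  have eq_sum l : N < d * z l -> s * z l = \sum_i u i.
    move=> zl; apply: (large_entry_eq (E := fun j i => E i j)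
      d_gt0 s_gt0 z_ge0 z_unit u_ge0 z_eq u_eq).
    exact: le_lt_trans zl.
  by rewrite !eq_sum.
rewrite -z_unit mulr_suml -sumrB; apply: le_trans (ler_norm_sum _ _ _) _.
apply: (@le_trans _ _ (\sum_(k : J) N / d)); last first.
  rewrite sumr_const -[leLHS]mulr_natl expr2 mulrA.
  by rewrite !ler_wpM2r ?invr_ge0 ?(ltW d_gt0) // (le_trans ler01).
(* The summand is [z k * (z j - z k)]: zero for large [k], and otherwise of absolute value at most
   [N / d], as both entries lie in [0, 1]. *)
apply: ler_sum => k _; rewrite expr2 -mulrBr normrM.
have [zk|zk] := ltP N (d * z k).
  rewrite (zconst k) // subrr normr0 mulr0 divr_ge0 // ltW //.
  exact: lt_le_trans ltr01 N_ge1.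
rewrite (ger0_norm (z_ge0 k)) -[leRHS]mulr1.
rewrite ler_pM // ?ler_pdivlMr ?(mulrC _ d) //.
have z_le1 := unit_vector_le1 z_ge0 z_unit.
have := (z_ge0 k, z_ge0 j, z_le1 k, z_le1 j).
by move=> [[[? ?] ?] ?]; rewrite ler_norml; lra.
Qed.

(** If one factor is small, the product is at most [N ^ 2 * (N / d)], since [s <= N ^ 2]. If both
    are large, [s * u i] is the sum of [z] and [large_entry_sum] applies. *)
Lemma stationary_near_biclique i j :
  `|s * u i * z j - ((N < d * u i) && (N < d * z j))%:R| <= N ^+ 3 / d.
Proof.
have N_ge0 : 0 <= N by exact: le_trans N_ge1.
have s_le : s <= N ^+ 2.
  have := stationary_scale_le d_gt0 s_gt0 u_ge0 u_unit z_ge0 z_unit u_eq.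
  by move=> /le_trans; apply; rewrite expr2 ler_pM.
have small x y : 0 <= x -> 0 <= y <= 1 -> d * x <= N ->
    `|s * x * y| <= N ^+ 3 / d.
  move=> x0 /andP[y0 y1] xN; rewrite ger0_norm ?mulr_ge0 ?(ltW s_gt0) //.
  apply: (@le_trans _ _ (s * x)).
    by rewrite ler_piMr ?mulr_ge0 ?(ltW s_gt0).
  rewrite exprSr -mulrA ler_pM ?(ltW s_gt0) //.
  by rewrite ler_pdivlMr // mulrC.
have uP k : 0 <= u k <= 1 by rewrite u_ge0 unit_vector_le1.
have zP k : 0 <= z k <= 1 by rewrite z_ge0 unit_vector_le1.
have [ui|ui] := ltP N (d * u i); last by rewrite subr0 small.
have [zj|zj] := ltP N (d * z j); last by rewrite subr0 mulrAC small.
rewrite (large_entry_eq d_gt0 s_gt0 u_ge0 u_unit z_ge0 u_eq z_eq); last first.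
  exact: le_lt_trans ui.
apply: le_trans (large_entry_sum zj) _.
by rewrite ler_pM2r ?invr_gt0 // ler_weXn2l.
Qed.

End NearBiclique.

(** * Frobenius norm and positive part *)

Section Frobenius.
Variables (R : realType) (p q : nat).
Implicit Types A B : 'M[R]_(p, q).

Lemma sqr_frobenius_norm A :
  frobenius_norm A ^+ 2 = \sum_i \sum_j A i j ^+ 2.
Proof.
rewrite sqr_sqrtr // sumr_ge0 // => i _.
by apply: sumr_ge0 => j _; exact: sqr_ge0.
Qed.

Lemma frobenius_norm_ge0 A : 0 <= frobenius_norm A.
Proof. exact: sqrtr_ge0. Qed.

Lemma frobenius_norm_eq0 A : (frobenius_norm A == 0) = (A == 0).
Proof.
have sum0 i : 0 <= \sum_j A i j ^+ 2 by apply: sumr_ge0 => j _; exact: sqr_ge0.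
apply/idP/eqP => [/eqP nA|->]; last first.
  rewrite sqrtr_eq0 big1 // => i _; rewrite big1 // => j _.
  by rewrite mxE expr0n.
have /eqP := sqr_frobenius_norm A; rewrite nA expr0n eq_sym.
rewrite psumr_eq0 // => /allP sumA; apply/matrixP => i j; rewrite mxE.
have /= := sumA i (mem_index_enum i); rewrite psumr_eq0; last first.
  by move=> k _; exact: sqr_ge0.
by move=> /allP/(_ j (mem_index_enum j)) /=; rewrite sqrf_eq0 => /eqP.
Qed.

Lemma frobenius_norm_gt0 A : (0 < frobenius_norm A) = (A != 0).
Proof. by rewrite lt0r frobenius_norm_ge0 frobenius_norm_eq0 andbT. Qed.

Lemma frobenius_normZ (c : R) A :
  frobenius_norm (c *: A) = `|c| * frobenius_norm A.
Proof.
rewrite -sqrtr_sqr -sqrtrM ?sqr_ge0 // mulr_sumr; congr Num.sqrt.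
apply: eq_bigr => i _; rewrite mulr_sumr; apply: eq_bigr => j _.
by rewrite mxE exprMn.
Qed.

(** The sharp factor is the square root of [p * q]; the cruder one comes from a natural number being
    at most its square. *)
Lemma frobenius_norm_le (c : R) A :
  0 <= c -> (forall i j, `|A i j| <= c) -> frobenius_norm A <= (p * q)%:R * c.
Proof.
move=> c0 Ac.
rewrite -(@ler_pXn2r _ 2) ?nnegrE ?frobenius_norm_ge0 ?mulr_ge0 //.
rewrite sqr_frobenius_norm; apply: (@le_trans _ _ ((p * q)%:R * c ^+ 2)).
  rewrite natrM -mulrA 2!mulr_natl -[p in leRHS]card_ord.
  rewrite -[q in leRHS]card_ord -!sumr_const.
  apply: ler_sum => i _; apply: ler_sum => j _.
  by rewrite -[leLHS]real_normK ?num_real // ler_pXn2r ?nnegrE.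
rewrite exprMn ler_wpM2r ?sqr_ge0 // -natrX ler_nat.
by case: (p * q)%N => // k; rewrite expnS leq_pmulr.
Qed.

Lemma pos_partZ (c : R) A : 0 <= c -> pos_part (c *: A) = c *: pos_part A.
Proof.
by move=> c0; apply/matrixP => i j; rewrite !mxE maxr_pMr // mulr0.
Qed.

End Frobenius.

(** * Stationary points parametrised by unit row vectors *)

Section UnitStationary.
Variables (R : realType) (m n : nat).
Implicit Types (M : 'M[R]_(m, n)) (w : 'rV[R]_n).

(** For [w] of norm 1 the denominator in the first KKT equation disappears, and [v] becomes this
    function of [w]. *)
Definition left_factor M w : 'cV[R]_m := pos_part (M *m w^T).

(** The second KKT equation is multiplied by the squared norm of [v], so that both sides are
    continuous in [w] without division. *)
Definition unit_stationary M w : Prop :=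
  [/\ frobenius_norm w = 1, left_factor M w != 0 &
      frobenius_norm (left_factor M w) ^+ 2 *: w
      = pos_part ((left_factor M w)^T *m M)].

Lemma unit_stationary_stationary M w :
  unit_stationary M w -> stationary_set M (left_factor M w *m w).
Proof.
case=> w1 v0 wE.
have w0 : w != 0 by rewrite -frobenius_norm_gt0 w1.
have v_gt0 : 0 < frobenius_norm (left_factor M w) ^+ 2.
  by rewrite exprn_gt0 ?frobenius_norm_gt0.
split; last first.
  exists (left_factor M w), w; split => //.
    by rewrite w1 expr1n invr1 scale1r.
  by rewrite pos_partZ ?invr_ge0 ?ltW // -wE scalerA mulVf ?scale1r ?lt0r_neq0.
move/cV0Pn: v0 => [i vi]; move/rV0Pn: w0 => [j wj].
by apply/matrix0Pn; exists i, j; rewrite mxE big_ord1 mulf_neq0.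
Qed.

(** The product is unchanged when [v] is multiplied and [w] divided by the norm of [w]; positive
    homogeneity of [pos_part] carries both equations over. *)
Lemma stationary_unit_stationary M A : stationary_set M A ->
  exists2 w, unit_stationary M w & A = left_factor M w *m w.
Proof.
case=> _ [v [w [-> v0 w0 vE wE]]].
set c := frobenius_norm w; have c_gt0 : 0 < c by rewrite frobenius_norm_gt0.
have c_neq0 := lt0r_neq0 c_gt0.
have v_gt0 : 0 < frobenius_norm v by rewrite frobenius_norm_gt0.
have lfE : left_factor M (c^-1 *: w) = c *: v.
  rewrite vE -/c -pos_partZ ?ltW // /left_factor scalerA linearZ /= -scalemxAr.
  by congr (pos_part (_ *: _)); rewrite expr2 invfM mulrA mulfV ?mul1r.
exists (c^-1 *: w); rewrite /unit_stationary lfE; last first.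
  by rewrite -scalemxAl -scalemxAr scalerA mulfV ?scale1r.
split.
- by rewrite frobenius_normZ ger0_norm ?invr_ge0 ?ltW // mulVf.
- by rewrite -frobenius_norm_gt0 frobenius_normZ ger0_norm ?mulr_gt0 // ltW.
- rewrite frobenius_normZ (ger0_norm (ltW c_gt0)) [_^T]linearZ -scalemxAl.
  rewrite pos_partZ ?ltW //.
  rewrite wE scalerA -pos_partZ; last first.
    by rewrite mulr_ge0 ?sqr_ge0 // invr_ge0 ltW.
  rewrite scalerA -pos_partZ ?ltW //; congr (pos_part (_ *: _)).
  by rewrite exprMn expr2; field; rewrite c_neq0 lt0r_neq0.
Qed.

End UnitStationary.

(** * Continuity of sums, powers, norms and finite minima *)

Section Continuity.
Variables (R : realType) (T : topologicalType).

Lemma continuous_sum (I : Type) (r : seq I) (f : I -> T -> R) :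
  (forall i, continuous (f i)) -> continuous (fun x => \sum_(i <- r) f i x).
Proof. by move=> fc; apply: continuous_big => //; exact: add_continuous. Qed.

Lemma continuous_exprn (k : nat) (f : T -> R) :
  continuous f -> continuous (fun x => f x ^+ k).
Proof.
move=> fc x; apply: (@continuous_comp _ _ _ f (fun y => y ^+ k)).
  exact: fc.
exact: exprn_continuous.
Qed.

Lemma continuous_frobenius_norm (p q : nat) (f : T -> 'M[R]_(p, q)) :
  (forall i j, continuous (fun x => f x i j)) ->
  continuous (fun x => frobenius_norm (f x)).
Proof.
move=> fc x.
apply: (@continuous_comp _ _ _
  (fun x => \sum_i \sum_j f x i j ^+ 2) Num.sqrt).
  apply: continuous_sum => i; apply: continuous_sum => j.
  exact: continuous_exprn.
exact: sqrt_continuous.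
Qed.

Lemma continuous_bigmin (I : Type) (r : seq I) (f0 : T -> R) (f : I -> T -> R) :
  continuous f0 -> (forall i, continuous (f i)) ->
  continuous (fun x => \big[Num.min/f0 x]_(i <- r) f i x).
Proof.
move=> f0c fc; elim: r => [|i r IHr] x.
  by under eq_fun do rewrite big_nil; exact: f0c.
under eq_fun do rewrite big_cons.
by apply: continuous_min; [exact: fc|exact: IHr].
Qed.

End Continuity.

(** * Compactness of the normalised stationary vectors *)

Section Compactness.
Variables (R : realType) (m n : nat) (M : 'M[R]_(m, n)).

Lemma continuous_left_factor i :
  continuous (fun w : 'rV[R]_n => left_factor M w i 0).
Proof.
have -> : (fun w : 'rV[R]_n => left_factor M w i 0) =
    (fun w => Num.max 0 (\sum_j M i j * w 0 j)).
  by apply/funext => w; rewrite !mxE; under eq_bigr do rewrite mxE.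
move=> w; apply: continuous_max; first exact: cst_continuous.
apply: continuous_sum => j {}w; apply: continuousM; first exact: cst_continuous.
exact: coord_continuous.
Qed.

Lemma continuous_left_factor_mul i j :
  continuous (fun w : 'rV[R]_n => (left_factor M w *m w) i j).
Proof.
have -> : (fun w : 'rV[R]_n => (left_factor M w *m w) i j) =
    (fun w => left_factor M w i 0 * w 0 j).
  by apply/funext => w; rewrite mxE big_ord1.
move=> w; apply: continuousM; first exact: continuous_left_factor.
exact: coord_continuous.
Qed.

(** Being nonzero is an open condition on the left factor; the uniform bound [c] replaces it by a
    closed one. The unit norm puts the set inside the cube [-1, 1]^n, where it is cut out by closed
    conditions. *)
Lemma unit_stationary_compact (c : R) : 0 < c ->
  (forall w, unit_stationary M w -> c <= frobenius_norm (left_factor M w)) ->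
  compact [set w | unit_stationary M w].
Proof.
move=> c_gt0 le_c; pose v w := left_factor M w.
have fwc : continuous (fun w : 'rV[R]_n => frobenius_norm w).
  by apply: continuous_frobenius_norm => i j; exact: coord_continuous.
have vc : continuous (fun w => frobenius_norm (v w)).
  apply: continuous_frobenius_norm => i j.
  by rewrite ord1; exact: continuous_left_factor.
pose h j w := frobenius_norm (v w) ^+ 2 * w 0 j
  - Num.max 0 (\sum_i v w i 0 * M i j).
have pE w j : pos_part ((v w)^T *m M) 0 j = Num.max 0 (\sum_i v w i 0 * M i j).
  by rewrite !mxE; under eq_bigr do rewrite mxE.
have lc j : continuous (fun w : 'rV[R]_n => frobenius_norm (v w) ^+ 2 * w 0 j).
  move=> w; apply: (@continuousM _ _ (fun w => frobenius_norm (v w) ^+ 2)).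
    exact: continuous_exprn.
  exact: coord_continuous.
have rc j : continuous (fun w => Num.max 0 (\sum_i v w i 0 * M i j)).
  move=> w; apply: continuous_max; first exact: cst_continuous.
  apply: continuous_sum => i {}w; apply: continuousM.
    exact: continuous_left_factor.
  exact: cst_continuous.
have hc j : continuous (h j).
  by move=> w; exact: (continuousB (lc j w) (rc j w)).
rewrite (_ : [set w | _] =
  [set w : 'rV[R]_n | forall j, `[-1, 1]%classic (w ord0 j)] `&`
  ((fun w => frobenius_norm w) @^-1` [set x | x = 1] `&`
   (fun w => frobenius_norm (v w)) @^-1` [set x | c <= x] `&`
   \bigcap_j (h j @^-1` [set x | x = 0]))).
  apply: compact_closedI.
    apply: (@rV_compact R n (fun=> `[-1, 1]%classic)) => j.
    exact: segment_compact.
  apply: closedI; first apply: closedI.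
  - by apply: preimage_closed => [w _|]; [exact: fwc|exact: closed_eq].
  - by apply: preimage_closed => [w _|]; [exact: vc|exact: closed_ge].
  - apply: closed_bigI => j _.
    by apply: preimage_closed => [w _|]; [exact: hc|exact: closed_eq].
apply/seteqP; split=> w /=.
  move=> uw; have [w1 v0 wE] := uw; split; last first.
    split; first by split; [exact: w1|exact: le_c].
    by move=> j _; rewrite /h /= -pE -wE mxE subrr.
  move=> j; rewrite /= in_itv /= -ler_norml -(@expr_le1 _ 2) //.
  rewrite real_normK ?num_real // -(expr1n _ 2) -w1 sqr_frobenius_norm big_ord1.
  by rewrite (bigD1 j) //= lerDl sumr_ge0 // => k _; exact: sqr_ge0.
case=> _ [[w1 cv] hw]; split => //.
  by rewrite -frobenius_norm_gt0 (lt_le_trans c_gt0).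
apply/matrixP => i j; rewrite ord1 mxE pE.
by have /eqP := hw j Logic.I; rewrite subr_eq0 => /eqP.
Qed.

End Compactness.

(** * Attained distances to a finite set of matrices *)

Lemma finite_biclique_set (R : realType) (m n : nat) (Mb : 'M[R]_(m, n)) :
  finite_set (biclique_set Mb).
Proof.
pose f (x : 'M[bool]_(m, n)) : 'M[R]_(m, n) := map_mx (fun b : bool => b%:R) x.
apply: (@sub_finite_set _ _ (range f)); last first.
  by apply: finite_image; exact: finite_finset.
move=> _ [v [w [-> bv bw _]]].
exists (map_mx (fun a => a == 1) (v *m w)) => //.
apply/matrixP => i j; rewrite !mxE big_ord1.
by case: (bv i 0) (bw 0 j) => -> [] ->;
  rewrite ?mulr0 ?mul0r ?mul1r ?eqxx // eq_sym oner_eq0.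
Qed.

(** The head [B0] seeds the iterated minimum, so the value is a distance to a member even when [s]
    is empty. *)
Lemma is_dist_to_bigmin (R : realType) (m n : nat) (B0 A : 'M[R]_(m, n)) s :
  is_dist_to [set` B0 :: s] A
    (\big[Num.min/frobenius_norm (A - B0)]_(B <- s) frobenius_norm (A - B)).
Proof.
split; last first.
  move=> _ [B Bs <-]; move: Bs; rewrite /= inE => /orP[/eqP ->|Bs].
    exact: bigmin_le_id.
  exact: (@ge_bigmin_seq _ _ _ s _ B xpredT).
elim: s => [|B s [B' B's IHs]].
  by rewrite big_nil; exists B0 => //=; rewrite inE eqxx.
rewrite big_cons; case: leP => _.
  by exists B => //=; rewrite !inE eqxx orbT.
exists B' => //=; move: B's => /=; rewrite !inE => /orP[->//|->].
by rewrite !orbT.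
Qed.

(** The distance to a finite set is a minimum of finitely many continuous functions, so it is
    maximal somewhere on [K]; the maximiser is returned so that [mu] can be estimated there. *)
Lemma compact_is_max_dist (R : realType) (T : topologicalType) (m n : nat)
    (K : set T) (f : T -> 'M[R]_(m, n)) (F : set 'M[R]_(m, n)) :
  compact K -> K !=set0 -> (forall i j, continuous (fun x => f x i j)) ->
  finite_set F -> F !=set0 ->
  exists2 x, K x & exists2 mu,
    is_dist_to F (f x) mu & is_max_dist [set f x | x in K] F mu.
Proof.
move=> Kc K0 fc /finite_seqP[[|B0 s] ->] [B //= _].
pose g x := \big[Num.min/frobenius_norm (f x - B0)]_(B <- s)
  frobenius_norm (f x - B).
have gc : continuous g.
  have dc C : continuous (fun x => frobenius_norm (f x - C)).
    apply: continuous_frobenius_norm => i j x; under eq_fun do rewrite !mxE.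
    by apply: cvgB; [exact: fc|exact: cst_continuous].
  exact: continuous_bigmin.
have [x Kx maxx] := compact_EVT_max K0 Kc (continuous_subspaceT gc).
rewrite inE in Kx; exists x => //; exists (g x); first exact: is_dist_to_bigmin.
split; first by exists (f x); [exists x|exact: is_dist_to_bigmin].
move=> delta [_ [y Ky <-] [Fd ld]].
apply: le_trans (maxx y _); last by rewrite inE.
by apply: ld; have [] := is_dist_to_bigmin B0 (f y) s.
Qed.

(** If [i] is joined to all of [L], this averages ones over [L]. Otherwise a single penalty [- d]
    cancels the remaining terms, whose total is at most [#|J| <= d]. At the indicator vectors of a
    maximal biclique this is a KKT equation. *)
Lemma maximal_biclique_eq (R : realFieldType) (I J : finType)
    (E : I -> J -> bool) (d : R) (L : {set J}) (i : I) :
  L != finset.set0 -> #|J|%:R <= d ->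
  Num.max 0 (#|L|%:R^-1 * \sum_j (if E i j then 1 else - d) * (j \in L)%:R)
  = [forall j in L, E i j]%:R.
Proof.
move=> L0 le_d; have L_gt0 : 0 < #|L|%:R :> R by rewrite ltr0n card_gt0.
have [/forall_inP EL|] := boolP [forall j in L, E i j].
  rewrite (eq_bigr (fun j => (j \in L)%:R)) => [|j _].
    by rewrite -natr_sum -big_mkcond /= sum1_card mulVf ?lt0r_neq0 // max_r.
  case: ifPn => [_|nE]; first by rewrite mul1r.
  by case: (boolP (j \in L)) nE => [/EL ->|_]; rewrite ?mulr0.
move=> /forall_inPn[j0 j0L nE]; rewrite max_l // pmulr_rle0 ?invr_gt0 //.
rewrite (bigD1 j0) //= (negbTE nE) j0L mulr1 addrC subr_le0.
apply: (le_trans _ le_d).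
rewrite -sumr_const [leRHS](bigD1 j0) //= ler_wpDl // ler_sum // => j _.
case: (E i j) (j \in L) => -[]; rewrite ?mul1r ?mulr1 ?mulr0 //.
by apply: (@le_trans _ _ 0) => //; rewrite oppr_le0 (le_trans _ le_d).
Qed.

(** * Application to the penalized adjacency matrix *)

Section PenalizedAdjacency.
Variables (R : realType) (m n : nat) (e : rel ('I_m + 'I_n)) (d : R).
Local Notation M := (penalized_mx d (adjacency_mx e)).

Lemma penalized_adjacencyE i j :
  M i j = if e (inl i) (inr j) then 1 else - d.
Proof. by rewrite !mxE mulr1; case: (e _ _) => /=; ring. Qed.

(** Passage to the symmetric form with scale [s]: the second equation, stated with [s ^ 2], loses
    one factor [s] when the left factor is replaced by the unit vector [u]. *)
Lemma unit_stationary_system w : unit_stationary M w ->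
  let s := frobenius_norm (left_factor M w) in
  let u i := left_factor M w i 0 / s in
  [/\ 0 < s, forall i, 0 <= u i, forall j, 0 <= w 0 j,
      \sum_i u i ^+ 2 = 1 /\ \sum_j w 0 j ^+ 2 = 1 &
      (forall i, s * u i = Num.max 0
         (\sum_j (if e (inl i) (inr j) then 1 else - d) * w 0 j)) /\
      (forall j, s * w 0 j = Num.max 0
         (\sum_i (if e (inl i) (inr j) then 1 else - d) * u i))].
Proof.
set v := left_factor M w => -[w1 v0 wE] s u.
have s_gt0 : 0 < s by rewrite frobenius_norm_gt0.
have s_neq0 := lt0r_neq0 s_gt0.
have vE i : v i 0 = Num.max 0
    (\sum_j (if e (inl i) (inr j) then 1 else - d) * w 0 j).
  by rewrite !mxE; under eq_bigr do rewrite penalized_adjacencyE mxE.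
have wjE j : s * w 0 j = Num.max 0
    (\sum_i (if e (inl i) (inr j) then 1 else - d) * u i).
  have /matrixP/(_ 0 j) := wE; rewrite mxE -/s => swE.
  apply: (mulfI s_neq0); rewrite mulrA -expr2 swE maxr_pMr ?ltW // mulr0 !mxE.
  congr (Num.max 0 _); rewrite mulr_sumr; apply: eq_bigr => i _.
  by rewrite penalized_adjacencyE mxE -/v mulrCA [s * _]mulrC divfK // mulrC.
split => //.
- by move=> i; rewrite divr_ge0 ?(ltW s_gt0) // -/v vE le_max lexx.
- by move=> j; rewrite -(pmulr_rge0 _ s_gt0) wjE le_max lexx.
- split; last by rewrite -(expr1n _ 2) -w1 sqr_frobenius_norm big_ord1.
  under eq_bigr do rewrite expr_div_n.
  rewrite -mulr_suml; have -> : \sum_i v i 0 ^+ 2 = s ^+ 2.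
    by rewrite sqr_frobenius_norm; apply: eq_bigr => i _; rewrite big_ord1.
  by rewrite mulfV // expf_neq0.
- by split=> // i; rewrite mulrC divfK.
Qed.

Lemma left_factor_ge1 w : 0 < d -> m%:R * m%:R < d ->
  unit_stationary M w -> 1 <= frobenius_norm (left_factor M w).
Proof.
move=> d_gt0 d_gt /unit_stationary_system[s0 u0 w0 [u1 w1] [uE wE]].
by apply: (stationary_scale_ge1 d_gt0 s0 u0 u1 w0 w1 uE wE); rewrite card_ord.
Qed.

Lemma unit_stationary_near_biclique w :
  (0 < m)%N -> 0 < d -> unit_stationary M w ->
  exists2 B, biclique_set (adjacency_mx e) B &
  frobenius_norm (left_factor M w *m w - B)
  <= (m * n)%:R * ((m + n)%:R ^+ 3 / d).
Proof.
move=> m_gt0 d_gt0 /unit_stationary_system[s0 u0 w0 [u1 w1] [uE wE]].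
set s := frobenius_norm _ in s0 uE wE u0 u1.
set N : R := (m + n)%:R.
have N_ge1 : 1 <= N by rewrite ler1n addn_gt0 m_gt0.
have mN : #|'I_m|%:R <= N by rewrite card_ord ler_nat leq_addr.
have nN : #|'I_n|%:R <= N by rewrite card_ord ler_nat leq_addl.
set u := (fun i => left_factor M w i 0 / s) in u0 u1 uE wE.
(* The biclique is spanned by the large entries; [N = m + n] is a common threshold for rows and
   columns. *)
exists ((\col_i (N < d * u i)%R%:R) *m (\row_j (N < d * w 0 j)%R%:R)).
  exists (\col_i (N < d * u i)%R%:R), (\row_j (N < d * w 0 j)%R%:R).
  split => // [i j|i j|i j]; rewrite !mxE.
  - by case: (_ < _); [right|left].
  - by case: (_ < _); [right|left].
  - rewrite -natrM ler_nat mulnb; case: andP => [[ui wj]|_]; last exact: leq0n.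
    rewrite lt0b; apply: (large_entries_edge d_gt0 s0 w0 w1 uE).
      exact: le_lt_trans wj.
    rewrite -(pmulr_rgt0 _ d_gt0).
    exact: lt_trans (lt_le_trans ltr01 N_ge1) ui.
apply: frobenius_norm_le => [|i j].
  by rewrite divr_ge0 ?exprn_ge0 ?(ltW d_gt0) // (le_trans ler01).
have -> : (left_factor M w *m w -
    (\col_i (N < d * u i)%R%:R) *m (\row_j (N < d * w 0 j)%R%:R)) i j
    = left_factor M w i 0 * w 0 j - ((N < d * u i) && (N < d * w 0 j))%:R.
  rewrite -mulnb natrM mxE; congr (_ + _); first by rewrite mxE big_ord1.
  by rewrite mxE; congr (- _); rewrite mxE big_ord1 !mxE.
have -> : left_factor M w i 0 = s * u i by rewrite mulrC divfK ?lt0r_neq0.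
exact: stationary_near_biclique d_gt0 s0 u0 u1 w0 w1 uE wE N_ge1 mN nN i j.
Qed.

Lemma stationary_set_image :
  stationary_set M =
  [set left_factor M w *m w | w in [set w | unit_stationary M w]].
Proof.
apply/seteqP; split=> A /=.
  by move=> /stationary_unit_stationary[w uw ->]; exists w.
by move=> [w uw <-]; exact: unit_stationary_stationary.
Qed.

(** Let [L] be the neighbourhood of one vertex, nonempty as no vertex is isolated, and [K] the
    common neighbours of [L]. Then [L] is in turn the set of common neighbours of [K], so the
    indicator vectors solve both equations. *)
Lemma stationary_set_nonempty : (0 < m)%N ->
  bipartite_graph e -> no_isolated_vertex e -> m%:R <= d -> n%:R <= d ->
  stationary_set M !=set0.
Proof.
move=> m_gt0 [esym emm _] conn md nd; pose i0 : 'I_m := Ordinal m_gt0.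
have [[i1|j0] _ e0] := conn (inl i0); first by have := emm i0 i1; rewrite e0.
pose L := [set j | e (inl i0) (inr j)]%SET.
pose K := [set i | [forall j in L, e (inl i) (inr j)]]%SET.
pose v : 'cV[R]_m := \col_i (i \in K)%:R.
pose w : 'rV[R]_n := \row_j (j \in L)%:R.
have i0K : i0 \in K by rewrite inE; apply/forall_inP => j; rewrite inE.
have j0L : j0 \in L by rewrite inE.
have K0 : K != finset.set0 by apply/set0Pn; exists i0.
have L0 : L != finset.set0 by apply/set0Pn; exists j0.
have LE j : (j \in L) = [forall i in K, e (inl i) (inr j)].
  apply/idP/forall_inP => [jL i|/(_ i0 i0K)]; last by rewrite inE.
  by rewrite inE => /forall_inP/(_ j jL).
have v0 : v != 0 by apply/cV0Pn; exists i0; rewrite mxE i0K oner_eq0.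
have w0 : w != 0 by apply/rV0Pn; exists j0; rewrite mxE j0L oner_eq0.
have sqr_bool (b : bool) : b%:R ^+ 2 = b%:R :> R.
  by case: b; rewrite ?expr1n ?expr0n.
exists (v *m w); split.
  apply/matrix0Pn; exists i0, j0.
  by rewrite mxE big_ord1 !mxE i0K j0L mulr1 oner_eq0.
exists v, w; split=> //; apply/matrixP => i j;
  rewrite ord1 [RHS]mxE [in RHS]mxE.
- have -> : frobenius_norm w ^+ 2 = #|L|%:R.
    rewrite sqr_frobenius_norm big_ord1 -sum1_card natr_sum [RHS]big_mkcond /=.
    by apply: eq_bigr => k _; rewrite mxE sqr_bool; case: (k \in L).
  rewrite [in LHS]mxE [i \in K]inE.
  rewrite -(maximal_biclique_eq (fun i j => e (inl i) (inr j))
    i L0 (d := d)) ?card_ord //.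
  congr (Num.max 0 (_ * _)); rewrite mxE; apply: eq_bigr => k _.
  by rewrite penalized_adjacencyE !mxE.
- have -> : frobenius_norm v ^+ 2 = #|K|%:R.
    rewrite sqr_frobenius_norm -sum1_card natr_sum [RHS]big_mkcond /=.
    by apply: eq_bigr => k _; rewrite big_ord1 mxE sqr_bool; case: (k \in K).
  rewrite [in LHS]mxE LE.
  rewrite -(maximal_biclique_eq (fun j i => e (inl i) (inr j))
    j K0 (d := d)) ?card_ord //.
  congr (Num.max 0 (_ * _)); rewrite mxE; apply: eq_bigr => k _.
  by rewrite penalized_adjacencyE !mxE mulrC.
Qed.

End PenalizedAdjacency.

(** * Uniform convergence of stationary points to bicliques *)

Theorem theorem7 (R : realType) (m n : nat) (hm : (0 < m)%N) (hn : (0 < n)%N)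
    (e : rel ('I_m + 'I_n)) (he : bipartite_graph e)
    (hconn : no_isolated_vertex e) (eps : R) (heps : 0 < eps) :
  exists D : R, forall d : R, 0 < d -> D < d ->
    exists2 mu : R,
      is_max_dist (stationary_set (penalized_mx d (adjacency_mx e)))
                  (biclique_set (adjacency_mx e)) mu
      & mu < eps.
Proof.
pose N : R := (m + n)%:R; pose C : R := (m * n)%:R * N ^+ 3.
have N_ge1 : 1 <= N by rewrite ler1n addn_gt0 hm.
have C_ge0 : 0 <= C by rewrite mulr_ge0 ?exprn_ge0.
(* [N * N] ensures [s >= 1] and [d >= N]; [C / eps] makes the error [C / d] less than [eps]. *)
exists (N * N + C / eps) => d d_gt0 d_gt.
have NN_lt : N * N < d.
  by apply: le_lt_trans d_gt; rewrite lerDl divr_ge0 // ltW.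
have N_le : N <= d by apply: le_trans (ltW NN_lt); rewrite ler_peMr.
have mN : m%:R <= N by rewrite ler_nat leq_addr.
have nN : n%:R <= N by rewrite ler_nat leq_addl.
set M := penalized_mx d _; set F := biclique_set _.
have cK : compact [set w | unit_stationary M w].
  apply: (@unit_stationary_compact _ _ _ _ 1) => // w.
  by apply: left_factor_ge1 => //; apply: le_lt_trans NN_lt; rewrite ler_pM.
have /[!stationary_set_image] -[_ [w0 uw0 _]] : stationary_set M !=set0.
  by apply: stationary_set_nonempty => //; apply: le_trans N_le.
have F0 : F !=set0.
  by have [B FB _] := unit_stationary_near_biclique hm d_gt0 uw0; exists B.
have [] := @compact_is_max_dist _ _ _ _ _
  (fun w => left_factor M w *m w) F cK _ _ _ F0.
- by exists w0.
- exact: continuous_left_factor_mul.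
- exact: finite_biclique_set.
(* [mu] is the distance at the maximiser [w], so the distance from there to one nearby biclique
   bounds it. *)
move=> w uw [mu [_ le_mu] max_mu]; exists mu => //.
have [B FB le_B] := unit_stationary_near_biclique hm d_gt0 uw.
have le_muB : mu <= frobenius_norm (left_factor M w *m w - B).
  by apply: le_mu; exists B.
apply: le_lt_trans (le_trans le_muB le_B) _.
rewrite mulrA -/N -/C ltr_pdivrMr // mulrC -ltr_pdivrMr //.
by apply: le_lt_trans d_gt; rewrite lerDr mulr_ge0 // (le_trans ler01).
Qed.
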